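(* Let $\alpha_\mu\in\mathbb{R}$ be a constant and set $$x_{\min} = \frac{15+4\sqrt{30}}{720},\qquad C = 4\sqrt{\tfrac{2}{15}}+\tfrac43-2\gamma+\log\!\left(\tfrac{1}{68}\left(4\sqrt{30}-15\right)\right),$$ where $\gamma$ is Euler's constant. Consider the massive Klein-Gordon field ($m^2>0$) on de Sitter spacetime with cosmological constant $\Lambda>0$ and curvature coupling $\xi = \frac{3}{16}-\frac{m^2}{4\Lambda}$. Call a value $x = \frac{m^2}{4\Lambda}>0$ a solution if, for this $m^2,\Lambda$ and $\xi=\frac3{16}-x$, the semi-classical Einstein equation $G_{ab}+\Lambda g_{ab}=8\pi G_{\rm N}\langle T_{ab}\rangle_{m,\xi}$ holds (in the Bunch-Davies vacuum, with renormalisation ambiguity constant $\alpha_\mu$); equivalently, if $x$ is a zero on $(0,\infty)$ of $$f(x) = 24x+\frac{17}{1440x}-\log(12x)-\frac83+2\psi\!\left(\tfrac32\right)-12\alpha_\mu .$$ Then solutions exist if $12\alpha_\mu\ge C$. Moreover: (a) if $12\alpha_\mu = C$, there is exactly one solution, namely $m^2=4x_{\min}\Lambda$; (b) if $12\alpha_\mu > C$, there are exactly two solutions, one with $m^2<4x_{\min}\Lambda$ and one with $m^2>4x_{\min}\Lambda$.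
   Context: The $(3+1)$-dimensional de Sitter metric with cosmological constant $\Lambda>0$ is $g = \frac{3}{\Lambda\,\eta^2}\left(-d\eta^2+dx^2+dy^2+dz^2\right)$ (one half-line of $\eta\neq 0$); $G_{ab}=R_{ab}-\frac12 R g_{ab}$ is its Einstein tensor and $R$ its scalar curvature ($R=4\Lambda$). $G_{\rm N}>0$ is Newton's constant, and $\psi=\Gamma'/\Gamma$ is the digamma function. The free Klein-Gordon field $\hat\Phi$ satisfies $(\Box - m^2-\xi R)\hat\Phi=0$. Its renormalised stress-energy tensor in the Bunch-Davies vacuum on de Sitter spacetime is taken to be given by the formula $$\langle T_{ab}\rangle_{m,\xi} = \frac{g_{ab}}{(8\pi)^2}\Big\{ m^2\big[m^2+(\xi-\tfrac16)R\big]\big[\psi(\tfrac32+\nu)+\psi(\tfrac32-\nu)-\ln(12m^2/R)\big] - \tfrac12(\xi-\tfrac16)^2R^2 + \tfrac{R^2}{2160} - m^2(\xi-\tfrac16)R - \tfrac{m^2R}{18}\Big\} - \frac{\alpha_\mu m^2\Lambda\, g_{ab}}{(8\pi)^2},$$ where $\nu^2 = \frac94-12(m^2/R+\xi)$ and the last term is the renormalisation ambiguity that remains after requiring the stress-energy tensor to vanish in the Minkowski limit $\Lambda\to0^+$; here the ambiguity coefficient $\alpha_\mu$ (in general a function of $\xi$) is taken to be a real constant. For $\xi=\frac{3}{16}-\frac{m^2}{4\Lambda}$ one has $\nu=0$. *)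

(* Defs.v *)
From mathcomp Require Import all_boot all_order all_algebra.
From mathcomp Require Import complex.
From mathcomp Require Import all_classical all_reals all_analysis.

Set Implicit Arguments.
Unset Strict Implicit.
Unset Printing Implicit Defensive.

Import Order.TTheory GRing.Theory Num.Theory.
Import numFieldNormedType.Exports.

Local Open Scope classical_set_scope.
Local Open Scope ring_scope.
Local Open Scope complex_scope.

Section SpecialFunctions.
Variable R : realType.

Definition eulerGamma : R :=
  lim ((fun n : nat => \sum_(1 <= k < n.+1) k%:R^-1 - ln (n%:R : R)) @ \oo).

Definition cexp (z : R[i]) : R[i] :=
  (expR (complex.Re z))%:C * (cos (complex.Im z) +i* sin (complex.Im z)).

(* Euler's limit n! n^z / (z (z+1) ... (z+n)): unlike the integral of
   t^(z-1) e^(-t), it converges at every z that is not a pole, as is needed for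
   the argument 3/2 - nu below, whose real part may be negative. *)
Definition cGamma (z : R[i]) : R[i]^o :=
  lim ((fun n : nat =>
    (n`!%:R * cexp (z * (ln (n%:R : R))%:C) / \prod_(k < n.+1) (z + k%:R)
      : R[i]^o)) @ \oo).

(* The derivative is the complex one: it is taken over the field R[i]. *)
Definition digamma (z : R[i]) : R[i] := derive1 cGamma z / cGamma z.

Definition rdigamma (x : R) : R := complex.Re (digamma x%:C).

End SpecialFunctions.

Section Curvature.
Variables (R : realType) (n : nat).
Variable g : 'rV[R]_n.+1 -> 'M[R]_n.+1.
Implicit Types (p : 'rV[R]_n.+1) (i j k l : 'I_n.+1).

Definition pderiv (F : 'rV[R]_n.+1 -> R^o) i p : R := 'D_(delta_mx 0 i) F p.

Definition christoffel k i j p : R :=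
  2^-1 * \sum_l invmx (g p) k l *
    (pderiv (fun q => g q l j) i p + pderiv (fun q => g q l i) j p
     - pderiv (fun q => g q i j) l p).

(* Sign convention: round spheres have positive curvature. *)
Definition ricci i j p : R :=
  \sum_k (pderiv (christoffel k i j) k p - pderiv (christoffel k i k) j p)
  + \sum_k \sum_l (christoffel k k l p * christoffel l i j p
                   - christoffel k j l p * christoffel l i k p).

Definition scalarCurvature p : R :=
  \sum_i \sum_j invmx (g p) i j * ricci i j p.

Definition einsteinTensor i j p : R :=
  ricci i j p - 2^-1 * scalarCurvature p * g p i j.

End Curvature.

Section DeSitter.
Variable R : realType.
Implicit Types (p : 'rV[R]_4) (Lambda GN alpha msq xi x : R).

(* Coordinates (eta, x, y, z); eta is the entry of index 0. *)
Definition deSitter Lambda p : 'M[R]_4 :=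
  (3 / (Lambda * p 0 0 ^+ 2)) *:
    \matrix_(i < 4, j < 4) (if i == j then if i == 0 then -1 else 1 else 0).

(* The half-line eta > 0 if s = false, and eta < 0 if s = true. *)
Definition halfLine (s : bool) : set 'rV[R]_4 :=
  [set p : 'rV[R]_4 | 0 < (-1) ^+ s * p 0 0].

(* nu = sqrt (9/4 - 12 (msq / Rs + xi)) is real or purely imaginary; the choice
   of the root is immaterial, and psi (3/2 + nu) + psi (3/2 - nu) is real. *)
Definition nu (Rs msq xi : R) : R[i] := sqrtC (9 / 4 - 12 * (msq / Rs + xi))%:C.

Definition psiSum (Rs msq xi : R) : R :=
  complex.Re (digamma ((3 / 2 : R)%:C + nu Rs msq xi)
              + digamma ((3 / 2 : R)%:C - nu Rs msq xi)).

(* Here msq stands for the squared mass. *)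
Definition stressEnergy Lambda alpha msq xi (a b : 'I_4) p : R :=
  let gab := deSitter Lambda p a b in
  let Rs := scalarCurvature (deSitter Lambda) p in
  gab / (8 * pi) ^+ 2 *
    (msq * (msq + (xi - 6^-1) * Rs) * (psiSum Rs msq xi - ln (12 * msq / Rs))
     - 2^-1 * (xi - 6^-1) ^+ 2 * Rs ^+ 2 + Rs ^+ 2 / 2160
     - msq * (xi - 6^-1) * Rs - msq * Rs / 18)
  - alpha * msq * Lambda * gab / (8 * pi) ^+ 2.

Definition semiclassicalEinstein (s : bool) Lambda GN alpha msq xi : Prop :=
  forall p, halfLine s p -> forall a b : 'I_4,
    einsteinTensor (deSitter Lambda) a b p + Lambda * deSitter Lambda p a b
    = 8 * pi * GN * stressEnergy Lambda alpha msq xi a b p.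

Definition solution (s : bool) Lambda GN alpha msq : Prop :=
  0 < msq /\
  semiclassicalEinstein s Lambda GN alpha msq (3 / 16 - msq / (4 * Lambda)).

Definition fsol alpha x : R :=
  24 * x + 17 / (1440 * x) - ln (12 * x) - 8 / 3 + 2 * rdigamma (3 / 2)
  - 12 * alpha.

Definition xmin : R := (15 + 4 * Num.sqrt 30) / 720.

Definition Cthr : R :=
  4 * Num.sqrt (2 / 15) + 4 / 3 - 2 * eulerGamma R
  + ln (68^-1 * (4 * Num.sqrt 30 - 15)).

End DeSitter.

(* Main.v *)
Require Import Defs.
From mathcomp Require Import all_boot all_order all_algebra.
From mathcomp Require Import complex ring lra zify.
From mathcomp Require Import all_classical all_reals all_analysis.

Import Order.TTheory GRing.Theory Num.Theory.
Import numFieldNormedType.Exports.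
Local Open Scope classical_set_scope.
Local Open Scope ring_scope.

(** On de Sitter space Ric = Lambda g, so the left-hand side of the Einstein
equation vanishes, and the equation says that the coefficient of g_ab in the
stress-energy tensor is 0; for nu = 0 this coefficient is f(x) up to a nonzero
factor.  The function x |-> 24 x + c / x - ln (12 x) decreases up to the root
x_min of 24 x - c / x = 1 and increases after it, by ln t < t - 1, and it is
unbounded at both ends, so the number of its solutions is decided by its value at
x_min.  That value involves psi(3/2) = 2 - gamma - 2 ln 2, which is read off
Euler's limit: if G_n(z) is the n-th approximant of Gamma(z), then the ratios
G_n(3/2 + h) / G_n(3/2) are products of factors
1 + delta_n h + O(|h|^2 / n^2), hence equal 1 + D_n h + O(|h|^2) uniformly in n,
and D_n = ln n - sum_(k <= n) 1 / (k + 3/2) converges to psi(3/2). *)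

(** * Monotonicity and level sets of [24 x + c / x - ln (12 x)] *)

Section FbaseRoots.
Set Implicit Arguments.
Unset Strict Implicit.
Variable R : realType.
Implicit Types x y : R.

Lemma ln_lt_subr1 x : 0 < x -> x != 1 -> ln x < x - 1.
Proof.
move=> x0 x1; have : ln x != 0 by rewrite ln_eq0.
by move=> /expR_gt1Dx; rewrite lnK ?posrE//; lra.
Qed.

Variables (c m : R).
Hypotheses (c_gt0 : 0 < c) (m_gt0 : 0 < m) (m_root : 24 * m - c / m = 1).

Definition fbase x : R := 24 * x + c / x - ln (12 * x).

Lemma fbase_sub x y : 0 < x -> 0 < y ->
  fbase y - fbase x = (y - x) * (24 - c / (x * y)) - ln (y / x).
Proof.
move=> x0 y0; rewrite /fbase (lnM _ x0) ?(lnM _ y0) ?ln_div ?posrE//; try lra.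
by field; rewrite !gt_eqF.
Qed.

(** Here [x (24 - c / (x y)) = 24 x - c / y] is at least [24 m - c / m = 1], so the rational part of
    [fbase_sub] is at least [(y - x) / x = y / x - 1], which exceeds [ln (y / x)]. *)
Lemma fbase_incr x y : m <= x -> x < y -> fbase x < fbase y.
Proof.
move=> mx xy; have m0 := m_gt0.
have x0 : 0 < x by lra.
have y0 : 0 < y by lra.
rewrite -subr_gt0 fbase_sub//.
have h : ln (y / x) < y / x - 1.
  by apply: ln_lt_subr1; rewrite ?divr_gt0// gt_eqF// ltr_pdivlMr// mul1r.
have : c * y^-1 <= c * m^-1.
  by rewrite ler_pM2l// lef_pV2 ?posrE ?(le_trans mx (ltW xy)).
move=> cy.
have key : 1 <= x * (24 - c / (x * y)).
  have -> : x * (24 - c / (x * y)) = 24 * x - c * y^-1.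
    by field; rewrite !gt_eqF.
  have := m_root.
  lra.
have E : y / x - 1 = (y - x) * x^-1 by field; rewrite gt_eqF.
have E2 : (y - x) * (24 - c / (x * y)) =
    (y - x) * x^-1 * (x * (24 - c / (x * y))) by field; rewrite !gt_eqF.
have p : 0 < (y - x) * x^-1 by rewrite mulr_gt0 ?invr_gt0 ?subr_gt0.
rewrite E2 subr_gt0; apply: (lt_le_trans h); rewrite E -[leLHS]mulr1.
by rewrite ler_pM2l.
Qed.

(** Mirror image: [y (24 - c / (x y)) = 24 y - c / x <= 1] bounds the rational part by
    [(y - x) / y], and [ln (y / x) = - ln (x / y) > (y - x) / y]. *)
Lemma fbase_decr x y : 0 < x -> x < y -> y <= m -> fbase y < fbase x.
Proof.
move=> x0 xy ym; have m0 := m_gt0.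
have y0 : 0 < y by lra.
rewrite -subr_lt0 fbase_sub//.
have h : ln (x / y) < x / y - 1.
  by apply: ln_lt_subr1; rewrite ?divr_gt0// lt_eqF// ltr_pdivrMr// mul1r.
have cx : c * m^-1 <= c * x^-1.
  by rewrite ler_pM2l// lef_pV2 ?posrE// ltW// (lt_le_trans xy).
have key : y * (24 - c / (x * y)) <= 1.
  have -> : y * (24 - c / (x * y)) = 24 * y - c * x^-1.
    by field; rewrite !gt_eqF.
  have := m_root.
  lra.
have E : x / y - 1 = - ((y - x) * y^-1) by field; rewrite gt_eqF.
have E2 : (y - x) * (24 - c / (x * y)) =
    (y - x) * y^-1 * (y * (24 - c / (x * y))) by field; rewrite !gt_eqF.
have p : 0 < (y - x) * y^-1 by rewrite mulr_gt0 ?invr_gt0 ?subr_gt0.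
have E3 : ln (y / x) = - ln (x / y) by rewrite -lnV ?posrE ?divr_gt0// invf_div.
have : (y - x) * y^-1 * (y * (24 - c / (x * y))) <= (y - x) * y^-1.
  by rewrite -[leRHS]mulr1 ler_pM2l.
by rewrite E2 E3; move: h; rewrite E; lra.
Qed.

Lemma fbase_continuous a b : 0 < a -> {within `[a, b], continuous fbase}.
Proof.
move=> a0; apply: continuous_in_subspaceT => x /set_mem/=; rewrite in_itv/= => /andP[ax _].
have x0 : 0 < x by exact: lt_le_trans ax.
rewrite /fbase; apply: cvgB; last first.
  suff: {for x, continuous (@ln R \o *%R 12)} by [].
  apply: continuous_comp; first exact: mulrl_continuous.
  by apply: continuous_ln; lra.
apply: cvgD; first exact: mulrl_continuous.
apply: cvgM; first exact: cvg_cst.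
by apply: cvgV; [rewrite gt_eqF | exact: cvg_id].
Qed.

(** From [ln t < t] at [t = 12 x]. This gives the growth at infinity, [fbase_ge_inv] the growth at
    0. *)
Lemma fbase_ge x : 0 < x -> 12 * x <= fbase x.
Proof.
move=> x0; rewrite /fbase; have := @ln_sublinear R (12 * x) ltac:(lra).
have : 0 <= c / x by rewrite ltW ?divr_gt0.
by lra.
Qed.

Lemma fbase_ge_inv x : 0 < x -> c / x <= fbase x.
Proof.
move=> x0; rewrite /fbase; have := @ln_sublinear R (12 * x) ltac:(lra).
by lra.
Qed.

Lemma fbase_root_right v : fbase m < v ->
  exists2 b, m < b & fbase b = v.
Proof.
move=> mv; have m0 := m_gt0; have fm := fbase_ge m0.
(* Since [v > fbase m >= 12 m > 0], this point lies to the right of [m] and [12 B > v]. *)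
pose B := m + v.
have B0 : 0 < B by rewrite /B; lra.
have fB := fbase_ge B0.
have vB : v < fbase B by rewrite /B in fB *; lra.
have mB : m <= B by rewrite /B; lra.
have [|b] := IVT mB (@fbase_continuous _ B m0) (v := v).
  by rewrite ge_min le_max (ltW mv) (ltW vB) orbT.
rewrite in_itv/= => /andP[mb _] fb; exists b => //.
rewrite lt_neqAle mb andbT; apply/eqP => e.
by move: mv; rewrite e fb ltxx.
Qed.

Lemma fbase_root_left v : fbase m < v ->
  exists2 a, 0 < a < m & fbase a = v.
Proof.
move=> mv; have m0 := m_gt0; have fm := fbase_ge m0.
(* Chosen so that [c / B = c / m + v > v], while [B <= m]. *)
pose B := (m^-1 + v / c)^-1.
have i0 : 0 < m^-1 by rewrite invr_gt0.
have v0 : 0 < v / c by rewrite divr_gt0 ?(lt_trans _ mv) ?(lt_le_trans _ fm) ?mulr_gt0.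
have B0 : 0 < B by rewrite /B invr_gt0; lra.
have fB := fbase_ge_inv B0.
have vB : v < fbase B.
  move: fB; rewrite {1}/B invrK mulrDr mulrCA mulfV ?gt_eqF// mulr1.
  by have := divr_gt0 c_gt0 m0; lra.
have mB : B <= m by rewrite -lef_pV2 ?posrE// /B invrK; lra.
have [|b] := IVT mB (@fbase_continuous _ _ B0) (v := v).
  by rewrite ge_min le_max (ltW mv) (ltW vB) orbT.
rewrite in_itv/= => /andP[Bb bm] fb; exists b => //.
rewrite (lt_le_trans B0 Bb) lt_neqAle bm andbT; apply/eqP => e.
by move: mv; rewrite -e fb ltxx.
Qed.

Lemma fbase_gt_min x : 0 < x -> x != m -> fbase m < fbase x.
Proof.
move=> x0; rewrite neq_lt => /orP[h|h].
  by apply: fbase_decr => //; rewrite lexx.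
by apply: fbase_incr => //; rewrite lexx.
Qed.

Lemma fbase_inj_left x y : 0 < x -> 0 < y -> x <= m -> y <= m ->
  fbase x = fbase y -> x = y.
Proof.
move=> x0 y0 xm ym e; case: (ltgtP x y) => // h.
  by have := fbase_decr x0 h ym; rewrite e ltxx.
by have := fbase_decr y0 h xm; rewrite e ltxx.
Qed.

Lemma fbase_inj_right x y : m <= x -> m <= y ->
  fbase x = fbase y -> x = y.
Proof.
move=> xm ym e; case: (ltgtP x y) => // h.
  by have := fbase_incr xm h; rewrite e ltxx.
by have := fbase_incr ym h; rewrite e ltxx.
Qed.

End FbaseRoots.

(** * Curvature of the de Sitter metric *)

Section DeSitterCurvature.
Set Implicit Arguments.
Unset Strict Implicit.
Variable R : realType.
Implicit Types (p : 'rV[R]_4).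

(** The two difference quotients coincide: moving along the [i]-th basis vector changes coordinate 0
    only if [i = 0], and then at unit speed. No differentiability is involved. *)
Lemma pderiv_comp_coord n (F : R -> R^o) (i : 'I_n.+1) (p : 'rV[R]_n.+1) :
  pderiv (fun q => F (q 0 0)) i p = 'D_((i == 0)%:R : R) F (p 0 0).
Proof.
rewrite /pderiv /derive.
apply: (congr1 (fun u : R -> R^o => lim (u @ 0^'))).
apply/funext => h /=; rewrite !mxE /= eq_sym; congr (_ *: (F (_ + _) - _)).
Qed.

Lemma near_coord_neq0 n (p : 'rV[R]_n.+1) : p 0 0 != 0 ->
  \forall q \near p, (q : 'rV[R]_n.+1) 0 0 != 0.
Proof.
move=> p0; have := @coord_continuous R 1 n.+1 0 0 p.
move/(_ [set x | x != 0]); apply; apply: open_nbhs_nbhs; split => //.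
Qed.

Lemma pderiv_inv_sqr n (a : R) i (p : 'rV[R]_n.+1) : p 0 0 != 0 ->
  pderiv (fun q => a / q 0 0 ^+ 2) i p = if i == 0 then - 2 * a / p 0 0 ^+ 3 else 0.
Proof.
move=> p0; rewrite (pderiv_comp_coord (fun t => a / t ^+ 2)).
case: eqVneq => _; last by rewrite derive0.
have h : is_derive (p 0 0) 1 (fun t : R => t ^+ 2) (2 * p 0 0).
  have := @is_deriveX R _ id 2 (p 0 0) 1 1 (is_derive_id _ _).
  by rewrite /= expr1 [_ *: _]mulr1.
have := @is_deriveV _ _ _ _ _ _ h.
rewrite expf_eq0 /= => /(_ p0) h2.
have h3 := @is_deriveZ _ _ _ _ a _ _ _ h2.
rewrite [LHS](_ : _ = 'D_1 (a \*: (fun t : R => (t ^+ 2)^-1)) (p 0 0))//.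
rewrite derive_val.
rewrite /GRing.scale/=; field; exact: p0.
Qed.

Lemma pderiv_inv n (a : R) i (p : 'rV[R]_n.+1) : p 0 0 != 0 ->
  pderiv (fun q => a / q 0 0) i p = if i == 0 then - a / p 0 0 ^+ 2 else 0.
Proof.
move=> p0; rewrite (pderiv_comp_coord (fun t => a / t)).
case: eqVneq => _; last by rewrite derive0.
have h2 := @is_deriveV _ _ _ _ _ p0 (is_derive_id (p 0 0) 1).
have h3 := @is_deriveZ _ _ _ _ a _ _ _ h2.
rewrite [LHS](_ : _ = 'D_1 (a \*: (fun t : R => t^-1)) (p 0 0))//.
rewrite derive_val /GRing.scale/=; field; exact: p0.
Qed.

(** Indexed by [nat], so that case analysis on ordinal indices reduces it by computation. *)
Definition minkowski (i j : nat) : R :=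
  if i == j then if i == 0%N then -1 else 1 else 0.

Lemma minkowskiC i j : minkowski i j = minkowski j i.
Proof. by rewrite /minkowski eq_sym; case: eqVneq => // ->. Qed.

Definition minkowski_mx : 'M[R]_4 := \matrix_(i, j) minkowski i j.

Lemma minkowski_mxK : minkowski_mx *m minkowski_mx = 1%:M.
Proof.
apply/matrixP => i j; rewrite !mxE !big_ord_recl big_ord0 !mxE /minkowski.
by case: i => -[|[|[|[|//]]]] ?; case: j => -[|[|[|[|//]]]] ?;
  rewrite /= ?mulr1 ?mul1r ?mul0r ?mulrNN ?mulr0 ?add0r ?addr0 ?mulr1.
Qed.

Lemma invmx_eq n (A B : 'M[R]_n) : A *m B = 1%:M -> invmx A = B.
Proof.
move=> AB; have [uA _] := mulmx1_unit AB.
by rewrite -[LHS]mulmx1 -AB mulKmx.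
Qed.

Lemma deSitterE (Lambda : R) p :
  deSitter Lambda p = (3 / Lambda / p 0 0 ^+ 2) *: minkowski_mx.
Proof.
rewrite /deSitter invfM mulrA; congr (_ *: _).
Qed.

Lemma invmx_deSitter (Lambda : R) p : 0 < Lambda -> p 0 0 != 0 ->
  invmx (deSitter Lambda p) = (p 0 0 ^+ 2 * Lambda / 3) *: minkowski_mx.
Proof.
move=> L0 p0; rewrite deSitterE; apply: invmx_eq.
rewrite -scalemxAl -scalemxAr minkowski_mxK scalerA -[RHS]scale1r.
by congr (_ *: _); field; rewrite p0 gt_eqF.
Qed.

(** Christoffel symbols times eta, from the formula for a conformally flat metric [e^(2 w)] times
    Minkowski with [w = - ln |eta|] up to a constant. The last sign is a plus because the time
    component of the inverse Minkowski metric is -1. *)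
Definition conf_christoffel (k i j : nat) : R :=
  - (((k == i) && (j == 0%N))%:R + ((k == j) && (i == 0%N))%:R
     + if k == 0%N then minkowski i j else 0).

Lemma pderiv_deSitter (Lambda : R) (l j i : 'I_4) p : p 0 0 != 0 ->
  pderiv (fun q => deSitter Lambda q l j) i p =
  (-2 * (3 / Lambda) / p 0 0 ^+ 3) * (if i == 0%N :> nat then minkowski l j else 0).
Proof.
move=> p0.
have -> : (fun q => deSitter Lambda q l j) =
   (fun q : 'rV_4 => (3 / Lambda * minkowski l j) / q 0 0 ^+ 2).
  by apply/funext => q; rewrite deSitterE !mxE mulrAC.
rewrite pderiv_inv_sqr//.
rewrite (_ : (i == 0) = (i == 0%N :> nat))//.
by case: ifP => _; rewrite ?mulr0// !mulrA mulrAC.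
Qed.

Lemma christoffel_deSitter (Lambda : R) (k i j : 'I_4) p :
  0 < Lambda -> p 0 0 != 0 ->
  christoffel (deSitter Lambda) k i j p = conf_christoffel k i j / p 0 0.
Proof.
move=> L0 p0; rewrite /christoffel.
transitivity (- (\sum_(l < 4) minkowski k l *
   ((if i == 0%N :> nat then minkowski l j else 0)
    + (if j == 0%N :> nat then minkowski l i else 0)
    - (if l == 0%N :> nat then minkowski i j else 0))) / p 0 0).
  rewrite mulNr mulr_suml mulr_sumr -sumrN; apply: eq_bigr => l _.
  rewrite !pderiv_deSitter// invmx_deSitter// !mxE -mulrDr -mulrBr.
  by field; rewrite p0 gt_eqF.
congr (_ / _); rewrite /conf_christoffel; congr (- _).
rewrite !big_ord_recl big_ord0 /minkowski.
by case: k => -[|[|[|[|//]]]] ?; case: i => -[|[|[|[|//]]]] ?;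
  case: j => -[|[|[|[|//]]]] ? /=; ring.
Qed.

Lemma pderiv_christoffel (Lambda : R) (k i j l : 'I_4) p :
  0 < Lambda -> p 0 0 != 0 ->
  pderiv (christoffel (deSitter Lambda) k i j) l p =
  (if l == 0%N :> nat then - conf_christoffel k i j else 0) / p 0 0 ^+ 2.
Proof.
move=> L0 p0.
transitivity (pderiv (fun q : 'rV_4 => conf_christoffel k i j / q 0 0) l p).
  (* The closed form holds only where eta is nonzero; this is an open condition, which is enough for
     a derivative. *)
  apply: near_eq_derive; near=> q; apply: christoffel_deSitter => //.
  by near: q; exact: near_coord_neq0.
rewrite pderiv_inv// (_ : (l == 0) = (l == 0%N :> nat))//.
by case: ifP; rewrite ?mul0r.
Unshelve. all: by end_near. Qed.

Lemma ricci_deSitter (Lambda : R) (i j : 'I_4) p : 0 < Lambda -> p 0 0 != 0 ->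
  ricci (deSitter Lambda) i j p = Lambda * deSitter Lambda p i j.
Proof.
move=> L0 p0; rewrite /ricci.
transitivity ((\sum_(k < 4)
   ((if k == 0%N :> nat then - conf_christoffel k i j else 0)
     - (if j == 0%N :> nat then - conf_christoffel k i k else 0))
  + \sum_(k < 4) \sum_(l < 4)
    (conf_christoffel k k l * conf_christoffel l i j
     - conf_christoffel k j l * conf_christoffel l i k)) / p 0 0 ^+ 2).
  rewrite mulrDl !mulr_suml; congr (_ + _); apply: eq_bigr => k _.
    by rewrite !pderiv_christoffel// -mulrBl.
  rewrite mulr_suml; apply: eq_bigr => l _.
  by rewrite !christoffel_deSitter//; field.
(* All terms carry eta^-2, so a numerical identity over the 16 index pairs remains: the numerators
   sum to 3 times the Minkowski metric. *)
transitivity (3 * minkowski i j / p 0 0 ^+ 2); last first.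
  by rewrite deSitterE !mxE; field; rewrite p0 gt_eqF.
congr (_ / _).
rewrite !big_ord_recl !big_ord0 /conf_christoffel /minkowski.
by case: i => -[|[|[|[|//]]]] ?; case: j => -[|[|[|[|//]]]] ? /=; ring.
Qed.

(** By [ricci_deSitter] and the symmetry of the metric this is [Lambda] times the trace of the 4 by
    4 identity. *)
Lemma scalarCurvature_deSitter (Lambda : R) p : 0 < Lambda -> p 0 0 != 0 ->
  scalarCurvature (deSitter Lambda) p = 4 * Lambda.
Proof.
move=> L0 p0; rewrite /scalarCurvature.
transitivity (Lambda * \tr (invmx (deSitter Lambda p) *m deSitter Lambda p)).
  rewrite /mxtrace mulr_sumr; apply: eq_bigr => i _.
  rewrite mxE mulr_sumr; apply: eq_bigr => j _.
  rewrite ricci_deSitter// mulrCA; congr (_ * (_ * _)).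
  by rewrite deSitterE !mxE minkowskiC.
rewrite mulVmx ?mxtrace1 1?mulrC//.
have [] := @mulmx1_unit _ _ (deSitter Lambda p) (invmx (deSitter Lambda p)); last by [].
rewrite invmx_deSitter// deSitterE -scalemxAl -scalemxAr minkowski_mxK scalerA -[RHS]scale1r.
by congr (_ *: _); field; rewrite p0 gt_eqF.
Qed.

Lemma einstein_deSitter (Lambda : R) (i j : 'I_4) p : 0 < Lambda -> p 0 0 != 0 ->
  einsteinTensor (deSitter Lambda) i j p + Lambda * deSitter Lambda p i j = 0.
Proof.
move=> L0 p0; rewrite /einsteinTensor ricci_deSitter// scalarCurvature_deSitter//.
by field.
Qed.

End DeSitterCurvature.

(** * The complex modulus as a real number *)

Section ComplexModulus.
Local Open Scope complex_scope.
Set Implicit Arguments.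
Unset Strict Implicit.
Variable R : realType.
Implicit Types (z w : R[i]) (x y : R).

(** The norm on [R[i]] has values in [R[i]]; its real part allows estimates in the ordered field
    [R]. *)
Definition cabs z : R := complex.Re `|z|.

Lemma cabsE z : `|z| = (cabs z)%:C.
Proof. by rewrite /cabs normc_def. Qed.

Lemma cabs_real x : cabs x%:C = `|x|.
Proof. by rewrite /cabs normc_def /= expr0n addr0 sqrtr_sqr. Qed.

Lemma cabs_ge0 z : 0 <= cabs z.
Proof. by rewrite /cabs normc_def sqrtr_ge0. Qed.

Lemma cabs_gt0 z : z != 0 -> 0 < cabs z.
Proof. by rewrite -normr_gt0 cabsE ltcR. Qed.

Lemma cabs0 : cabs 0 = 0. Proof. by rewrite /cabs normr0. Qed.

Lemma cabs1 : cabs 1 = 1. Proof. by rewrite /cabs normr1. Qed.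

Lemma cabs_eq0 z : cabs z = 0 -> z = 0.
Proof. by move=> z0; apply/eqP; rewrite -normr_eq0 cabsE z0. Qed.

Lemma cabsN z : cabs (- z) = cabs z. Proof. by rewrite /cabs normrN. Qed.

Lemma cabsM z w : cabs (z * w) = cabs z * cabs w.
Proof.
by apply: (@complexI R); rewrite rmorphM/= -!cabsE normrM.
Qed.

Lemma cabsV z : cabs z^-1 = (cabs z)^-1.
Proof.
by apply: (@complexI R); rewrite fmorphV/= -!cabsE normfV.
Qed.

Lemma cabsD z w : cabs (z + w) <= cabs z + cabs w.
Proof. by rewrite -lecR rmorphD/= -!cabsE ler_normD. Qed.

Lemma cabsB z w : cabs (z - w) <= cabs z + cabs w.
Proof. by rewrite -(cabsN w) cabsD. Qed.

Lemma cabs_Re z : `|complex.Re z| <= cabs z.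
Proof. by rewrite -lecR -cabsE normc_ge_Re. Qed.

Lemma cabs_Im z : `|complex.Im z| <= cabs z.
Proof.
rewrite /cabs normc_def/= -sqrtr_sqr.
by apply: ler_wsqrtr; rewrite lerDr sqr_ge0.
Qed.

Lemma cabs_le z : cabs z <= `|complex.Re z| + `|complex.Im z|.
Proof.
rewrite /cabs normc_def/= -[leRHS]ger0_norm ?addr_ge0// -sqrtr_sqr.
apply: ler_wsqrtr; rewrite sqrrD -(normrX 2 (complex.Re z)) -(normrX 2 (complex.Im z)).
rewrite !(ger0_norm (sqr_ge0 _)) lerD2r lerDl mulrn_wge0// mulr_ge0.
Qed.

(** A positive element of [R[i]] is real, so each epsilon of the complex topology is a real one. *)
Lemma cvg_cabs (T : Type) (F : set_system T) {FF : Filter F}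
    (u : T -> R[i]^o) (l : R[i]^o) :
  cabs (u x - l) @[x --> F] --> (0 : R) -> u @ F --> l.
Proof.
move=> h; apply/cvgrPdist_lt => e e0.
have eE : e = (complex.Re e)%:C by rewrite RRe_real// gtr0_real.
have re0 : 0 < complex.Re e by rewrite -ltcR -eE.
move/cvgr0Pnorm_lt : h => /(_ _ re0); apply: filterS => x.
by rewrite ger0_norm ?cabs_ge0// distrC cabsE eE ltcR.
Qed.

Lemma lim_cabs (T : Type) (F : set_system T) {FF : ProperFilter F}
    (u : T -> R[i]^o) (l : R[i]^o) :
  cabs (u x - l) @[x --> F] --> (0 : R) -> lim (u @ F) = l.
Proof. by move=> h; apply: cvg_lim; [exact: norm_hausdorff|exact: cvg_cabs]. Qed.

Lemma near0_cabs (d : R) : 0 < d -> \forall h \near (0 : R[i]^o)^', h != 0 /\ cabs h < d.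
Proof.
move=> d0; have d0C : 0 < d%:C by rewrite ltcR.
have h0 := @dnbhs0_lt _ (R[i]^o) _ d0C.
near=> h; split; first by near: h; rewrite near_withinE; apply: nearW.
by rewrite -ltcR -cabsE; near: h.
Unshelve. all: by end_near. Qed.

End ComplexModulus.

(** * Sequences with increments of order 1 / n^2 *)

Section Telescoping.
Local Open Scope complex_scope.
Set Implicit Arguments.
Unset Strict Implicit.
Variable R : realType.

(** A majorant of order 1 / n^2 whose partial sums are explicit, [1 - 1 / (n + 1)]. *)
Definition gap (n : nat) : R := n.+1%:R^-1 - n.+2%:R^-1.

Lemma gap_ge0 n : 0 <= gap n.
Proof. by rewrite /gap subr_ge0 lef_pV2 ?posrE ?ltr0n// ler_nat. Qed.

(** The increments telescope. The bound reached at [n] is available when the next increment is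
    estimated, which permits bootstrap arguments. *)
Lemma gap_induction (u : nat -> R) (A B : R) : 0 <= B -> u 0%N <= A ->
  (forall n, u n <= A + B * (1 - n.+1%:R^-1) -> u n.+1 <= u n + B * gap n) ->
  forall n, u n <= A + B * (1 - n.+1%:R^-1).
Proof.
move=> B0 uA uS; elim=> [|n IH]; first by rewrite invr1 subrr mulr0 addr0.
have := uS _ IH; rewrite /gap; move: IH.
set i := n.+1%:R^-1; set j := n.+2%:R^-1; lra.
Qed.

Lemma gap_bound (A B : R) n : 0 <= B -> A + B * (1 - n.+1%:R^-1) <= A + B.
Proof.
by move=> B0; rewrite lerD2l ler_piMr// gerBl invr_ge0.
Qed.

(** [B / (n + 1)] drops by exactly [B * gap n], so [u n - B / (n + 1)] is nondecreasing, and it is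
    bounded by [gap_induction]. *)
Lemma cvg_gap (u : nat -> R) (B : R) : 0 <= B ->
  (forall n, `|u n.+1 - u n| <= B * gap n) -> exists l : R, u @ \oo --> l.
Proof.
move=> B0 uB.
have uB' n : - (B * gap n) <= u n.+1 - u n <= B * gap n by rewrite -ler_norml.
have /cvg_ex[l ul] : cvgn (fun n => u n - B * harmonic n).
  apply: nondecreasing_is_cvgn.
    apply/nondecreasing_seqP => n; have := uB' n; rewrite /gap/=.
    by set i := n.+1%:R^-1; set j := n.+2%:R^-1 => /andP[]; lra.
  exists (u 0%N + B) => _ [n _ <-].
  have := @gap_induction u (u 0%N) B B0 (lexx _) _ n.
  have := gap_bound (u 0%N) n B0.
  have : 0 <= B * harmonic n by rewrite mulr_ge0 ?harmonic_ge0.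
  move=> h1 h2 h3; have : u n <= u 0%N + B * (1 - n.+1%:R^-1).
    by apply: h3 => k _; have /andP[] := uB' k; lra.
  by move: h1 h2; rewrite /harmonic/=; set i := n.+1%:R^-1; lra.
exists (l + B * 0).
rewrite (_ : u = (fun n => u n - B * harmonic n) + (fun n => B * harmonic n)); last first.
  by apply/funext => n /=; rewrite !fctE subrK.
by apply: cvgD => //; apply: cvgMl_tmp; exact: cvg_harmonic.
Qed.

Lemma ccvg_gap (u : nat -> R[i]) (B : R) : 0 <= B ->
  (forall n, cabs (u n.+1 - u n) <= B * gap n) ->
  exists l : R[i], cabs (u n - l) @[n --> \oo] --> (0 : R).
Proof.
move=> B0 uB.
have [a ha] : exists a : R, (fun n => complex.Re (u n)) @ \oo --> a.
  apply: (@cvg_gap _ B) => // n; apply: le_trans (uB n).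
  by rewrite -raddfB cabs_Re.
have [b hb] : exists b : R, (fun n => complex.Im (u n)) @ \oo --> b.
  apply: (@cvg_gap _ B) => // n; apply: le_trans (uB n).
  by rewrite -raddfB cabs_Im.
exists (a +i* b).
have h : (`|complex.Re (u n) - a| + `|complex.Im (u n) - b|) @[n --> \oo] --> (0 : R).
  rewrite -[0]addr0; apply: cvgD; rewrite -(@normr0 _ R); apply: cvg_norm;
  by apply/subr_cvg0.
apply: squeeze_cvgr (cvg_cst 0) h; apply: nearW => n.
by rewrite cabs_ge0 (le_trans (cabs_le _))//; case: (u n).
Qed.

End Telescoping.

(** * Taylor estimates for the complex exponential *)

Section Cexp.
Local Open Scope complex_scope.
Set Implicit Arguments.
Unset Strict Implicit.
Variable R : realType.
Implicit Types (z w : R[i]) (x y a b : R).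

Lemma cexp_real x : cexp x%:C = (expR x)%:C.
Proof. by rewrite /cexp /= cos0 sin0 mulr1. Qed.

Lemma cexpD z w : cexp (z + w) = cexp z * cexp w.
Proof.
case: z w => [a b] [c d]; rewrite /cexp /= expRD cosD sinD.
apply/eqP; rewrite eq_complex /=; apply/andP; split; apply/eqP; ring.
Qed.

(** Squaring [1 - a / 2 <= exp (- a / 2)] gives [exp a (1 - a / 2)^2 <= 1], and for [|a| <= 1] the
    polynomial [(1 + a + 2 a^2) (1 - a / 2)^2] is at least 1. *)
Lemma expR_taylor1 a : `|a| <= 1 -> `|expR a - 1 - a| <= 2 * a ^+ 2.
Proof.
rewrite ler_norml => /andP[a1 a2].
rewrite ger0_norm; last by have := expR_ge1Dx a; lra.
have h2 := expR_ge1Dx (- a / 2).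
have p := expR_gt0 (- a / 2).
have e0 := expR_gt0 a.
have E : expR a * expR (- a / 2) ^+ 2 = 1.
  by rewrite expr2 -expRD -expRD -[RHS]expR0; congr expR; field.
have le : expR a * (1 - a / 2) ^+ 2 <= 1.
  by rewrite -[leRHS]E ler_pM2l// ler_pXn2r// ?nnegrE; lra.
have : 1 <= (1 + a + 2 * a ^+ 2) * (1 - a / 2) ^+ 2.
  have -> : (1 + a + 2 * a ^+ 2) * (1 - a / 2) ^+ 2 =
    1 + a ^+ 2 * (5 / 4 + (- 7 / 4) * a + a ^+ 2 / 2) by field.
  rewrite lerDl mulr_ge0 ?sqr_ge0//; nra.
move=> /(le_trans le); rewrite ler_pM2r ?exprn_gt0//; lra.
Qed.

Lemma sin_abs_le b : `|sin b| <= `|b|.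
Proof.
wlog b0 : b / 0 < b.
  move=> H; have [b0|b0|<-] := ltgtP 0 b; [exact: H| |by rewrite sin0].
  by rewrite -normrN -sinN -(normrN b); apply: H; rewrite oppr_gt0.
have [c _ ] := @MVT R sin cos 0 b b0 (fun x _ => is_derive_sin x)
  (continuous_subspaceT (@continuous_sin R)).
rewrite sin0 !subr0 => ->; rewrite normrM -[leRHS]mul1r ler_wpM2r// cos_max//.
Qed.

Lemma cos_taylor0 b : `|cos b - 1| <= b ^+ 2.
Proof.
have -> : cos b = 1 - 2 * sin (b / 2) ^+ 2.
  have {1}-> : b = (b / 2) + (b / 2) by field.
  by rewrite cosD; have := cos2Dsin2 (b / 2); rewrite !expr2; lra.
have -> : 1 - 2 * sin (b / 2) ^+ 2 - 1 = - (2 * sin (b / 2) ^+ 2) by ring.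
rewrite normrN ger0_norm; last by rewrite pmulr_rge0 ?sqr_ge0.
have h := sin_abs_le (b / 2).
have : sin (b / 2) ^+ 2 <= (b / 2) ^+ 2.
  by rewrite -[leLHS]real_normK ?num_real// -[leRHS]real_normK ?num_real// ler_pXn2r// nnegrE.
by have := sqr_ge0 b; rewrite expr_div_n; lra.
Qed.

(** For [b > 0] the mean value theorem gives [sin b - b = (cos c - 1) b] with [0 < c < b], and
    [|cos c - 1| <= c^2 <= b]. *)
Lemma sin_taylor1 b : `|b| <= 1 -> `|sin b - b| <= b ^+ 2.
Proof.
wlog b0 : b / 0 < b.
  move=> H b1; have [b0|b0|<-] := ltgtP 0 b; [exact: H| |by rewrite sin0 subrr normr0 expr0n].
  have -> : sin b - b = - (sin (- b) - - b) by rewrite sinN; ring.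
  by rewrite normrN -[leRHS]sqrrN; apply: H; rewrite ?normrN ?oppr_gt0.
move=> b1.
have [c + ] := @MVT R sin cos 0 b b0 (fun x _ => is_derive_sin x)
  (continuous_subspaceT (@continuous_sin R)).
rewrite in_itv/= => /andP[c0 cb].
rewrite sin0 !subr0 => ->; rewrite -[X in _ - X]mul1r -mulrBl normrM.
rewrite (gtr0_norm b0) expr2 ler_wpM2r ?(ltW b0)//.
rewrite (gtr0_norm b0) in b1.
apply: (le_trans (cos_taylor0 c)); nra.
Qed.

(** The real and imaginary parts of the error are at most [6 r^2] and [7 r^2] with [r = cabs z]; 20
    leaves room. *)
Lemma cexp_taylor1 z : cabs z <= 1 -> cabs (cexp z - 1 - z) <= 20 * cabs z ^+ 2.
Proof.
move=> z1; have re := cabs_Re z; have im := cabs_Im z.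
move: (cabs z) z1 re im => r r1; case: z => a b /= ar br.
have a1 : `|a| <= 1 by exact: le_trans r1.
have b1 : `|b| <= 1 by exact: le_trans r1.
have r0 : 0 <= r by exact: le_trans ar.
apply: le_trans (cabs_le _) _ => /=.
rewrite !mul0r subr0 addr0 oppr0 addr0.
have a2 : a ^+ 2 <= r ^+ 2.
  by rewrite -[leLHS]real_normK ?num_real// ler_pXn2r// ?nnegrE.
have b2 : b ^+ 2 <= r ^+ 2.
  by rewrite -[leLHS]real_normK ?num_real// ler_pXn2r// ?nnegrE.
have e1 := expR_taylor1 a1.
have c1 := cos_taylor0 b.
have s1 := sin_taylor1 b1.
have r2 : r ^+ 2 <= r by rewrite expr2 ler_piMr.
have ea : `|expR a| <= 4.
  move: e1 a1; rewrite !ler_norml => /andP[_ ?] /andP[? ?].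
  by apply/andP; split; [have := expR_gt0 a|]; lra.
have ea1 : `|expR a - 1| <= 3 * r.
  rewrite (_ : expR a - 1 = (expR a - 1 - a) + a); last by ring.
  by apply: le_trans (ler_normD _ _) _; lra.
have h1 : `|expR a * cos b - 1 - a| <= 6 * r ^+ 2.
  rewrite (_ : _ - a = expR a * (cos b - 1) + (expR a - 1 - a)); last by ring.
  apply: le_trans (ler_normD _ _) _; rewrite normrM.
  have : `|expR a| * `|cos b - 1| <= 4 * r ^+ 2 by apply: ler_pM => //; lra.
  lra.
have h2 : `|expR a * sin b - b| <= 7 * r ^+ 2.
  rewrite (_ : _ - b = expR a * (sin b - b) + (expR a - 1) * b); last by ring.
  apply: le_trans (ler_normD _ _) _; rewrite !normrM.
  have : `|expR a| * `|sin b - b| <= 4 * r ^+ 2 by apply: ler_pM => //; lra.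
  have : `|expR a - 1| * `|b| <= 3 * r * r by apply: ler_pM => //; lra.
  rewrite -mulrA -expr2; lra.
by rewrite ?addr0 ?mul0r ?add0r; have := sqr_ge0 r; lra.
Qed.
End Cexp.

(** * Products of factors [1 + h delta_n + O(|h|^2 / n^2)], uniformly in [n] *)

Section ProductExpansion.
Local Open Scope complex_scope.
Set Implicit Arguments.
Unset Strict Implicit.
Variables (R : realType) (C : R) (h : R[i]) (Q r : nat -> R[i]) (D delta : nat -> R).
Hypotheses (C0 : 0 <= C) (hC : 3 * C * cabs h <= 1).
Hypotheses (Q0 : cabs (Q 0%N - 1) <= C * cabs h)
  (Q0' : cabs (Q 0%N - 1 - h * (D 0%N)%:C) <= C * cabs h ^+ 2)
  (QS : forall n, Q n.+1 = Q n * r n)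
  (DS : forall n, D n.+1 = D n + delta n)
  (r1 : forall n, cabs (r n - 1) <= C * cabs h * gap R n)
  (r2 : forall n, cabs (r n - 1 - h * (delta n)%:C) <= C * cabs h ^+ 2 * gap R n).

Let h0 := cabs_ge0 h.
Let Ch0 : 0 <= C * cabs h := mulr_ge0 C0 h0.

(** Bootstrap: as long as the bound holds, [hC] gives [|Q k| <= 2], so the increment [Q k (r k - 1)]
    is at most [2 C |h| gap k]. These sum to at most [2 C |h|], on top of the initial [C |h|]. *)
Lemma prod_near1 n : cabs (Q n - 1) <= 3 * C * cabs h.
Proof.
have B0 : 0 <= 2 * (C * cabs h) by rewrite mulr_ge0.
have := @gap_induction R (fun n => cabs (Q n - 1)) (C * cabs h) _ B0 Q0 _ n.
have := gap_bound (C * cabs h) n B0.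
move=> b; suff S : forall k,
   cabs (Q k - 1) <= C * cabs h + 2 * (C * cabs h) * (1 - k.+1%:R^-1) ->
   cabs (Q k.+1 - 1) <= cabs (Q k - 1) + 2 * (C * cabs h) * gap R k.
  by move=> /(_ S) a; apply: le_trans a (le_trans b _); lra.
move=> k kb; rewrite QS.
have -> : Q k * r k - 1 = (Q k - 1) + Q k * (r k - 1) by ring.
apply: le_trans (cabsD _ _) _; rewrite lerD2l cabsM -mulrA.
apply: ler_pM; rewrite ?cabs_ge0//.
have -> : Q k = (Q k - 1) + 1 by ring.
apply: le_trans (cabsD _ _) _; rewrite cabs1.
by have := le_trans kb (gap_bound (C * cabs h) k B0); have := hC; lra.
Qed.

Lemma prod_bounded n : cabs (Q n) <= 2.
Proof.
have -> : Q n = (Q n - 1) + 1 by ring.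
apply: le_trans (cabsD _ _) _; rewrite cabs1.
by have := prod_near1 n; have := hC; lra.
Qed.

Lemma prod_step n : cabs (Q n.+1 - Q n) <= 2 * (C * cabs h) * gap R n.
Proof.
have -> : Q n.+1 - Q n = Q n * (r n - 1) by rewrite QS; ring.
by rewrite cabsM -mulrA; apply: ler_pM; rewrite ?cabs_ge0// prod_bounded.
Qed.

(* The exact identity is E_(k+1) = E_k + (Q_k - 1) (r_k - 1) + (r_k - 1 - h delta_k)
   for the error E_k; the last two terms are of order |h|^2 gap_k. *)
Lemma prod_expansion n :
  cabs (Q n - 1 - h * (D n)%:C) <= (2 * C + 3 * C ^+ 2) * cabs h ^+ 2.
Proof.
have B0 : 0 <= (C + 3 * C ^+ 2) * cabs h ^+ 2.
  by rewrite mulr_ge0 ?sqr_ge0// addr_ge0// mulr_ge0 ?sqr_ge0.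
have := @gap_induction R (fun n => cabs (Q n - 1 - h * (D n)%:C)) _ _ B0 Q0' _ n.
have := gap_bound (C * cabs h ^+ 2) n B0.
move=> b a; have {}a := a _; apply: le_trans (a _) (le_trans b _) => {a b}; last first.
  by rewrite -mulrDl; apply: ler_wpM2r; [exact: sqr_ge0 | by have := C0; lra].
move=> k _; rewrite QS DS rmorphD/=.
have -> : Q k * r k - 1 - h * ((D k)%:C + (delta k)%:C) =
  (Q k - 1 - h * (D k)%:C) + ((Q k - 1) * (r k - 1) + (r k - 1 - h * (delta k)%:C)) by ring.
apply: le_trans (cabsD _ _) _; rewrite lerD2l.
apply: le_trans (cabsD _ _) _; rewrite cabsM.
have -> : (C + 3 * C ^+ 2) * cabs h ^+ 2 * gap R k =
  (3 * C * cabs h) * (C * cabs h * gap R k) + C * cabs h ^+ 2 * gap R k by ring.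
by apply: lerD => //; apply: ler_pM; rewrite ?cabs_ge0 ?prod_near1.
Qed.

End ProductExpansion.

(** * Euler's approximants near 3/2, relative to their values at 3/2 *)

Section GammaRatio.
Local Open Scope complex_scope.
Set Implicit Arguments.
Unset Strict Implicit.
Variable R : realType.
Implicit Types (h w : R[i]) (n k : nat).

Definition recip32 k : R := (3 / 2 + k%:R)^-1.
(* [lnstep 0] and the leading term of [digamma_seq 0] are 0 because [ln 0 = 0]. *)
Definition lnstep n : R := ln n.+1%:R - ln n%:R.
Definition digamma_seq n : R := ln n%:R - \sum_(k < n.+1) recip32 k.
(** The quotient G_n(3/2 + h) / G_n(3/2): the factorial and the power n^(3/2) cancel; see
    [gamma_seq_shift]. *)
Definition gamma_ratio h n : R[i] :=
  cexp (h * (ln n%:R)%:C) / \prod_(k < n.+1) (1 + h * (recip32 k)%:C).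
Definition ratio_step h n : R[i] :=
  cexp (h * (lnstep n)%:C) / (1 + h * (recip32 n.+1)%:C).

Lemma gamma_ratioS h n : gamma_ratio h n.+1 = gamma_ratio h n * ratio_step h n.
Proof.
rewrite /gamma_ratio /ratio_step big_ord_recr/= invfM [RHS]mulrACA -cexpD -mulrDr.
by rewrite -rmorphD/= /lnstep [ln n%:R + _]addrC subrK.
Qed.

Lemma digamma_seqS n :
  digamma_seq n.+1 = digamma_seq n + (lnstep n - recip32 n.+1).
Proof. by rewrite /digamma_seq /lnstep big_ord_recr/=; ring. Qed.

(** Both bounds are [ln (1 + t) <= t], at [t = - 1 / (x + 1)] and at [t = 1 / x]. *)
Lemma lnstep_bounds (x : R) : 0 < x -> (x + 1)^-1 <= ln (x + 1) - ln x <= x^-1.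
Proof.
move=> x0; have x10 : 0 < x + 1 by lra.
have i1 : 0 < (x + 1)^-1 by rewrite invr_gt0.
have i0 : 0 < x^-1 by rewrite invr_gt0.
have i2 : (x + 1)^-1 < 1 by rewrite invf_lt1//; lra.
have := @le_ln1Dx R (x^-1) ltac:(lra).
have := @le_ln1Dx R (- (x + 1)^-1) ltac:(lra).
have -> : 1 - (x + 1)^-1 = x / (x + 1) by field; rewrite gt_eqF.
have -> : 1 + x^-1 = (x + 1) / x by field; rewrite gt_eqF.
rewrite !ln_div ?posrE// => ? ?; apply/andP; split; lra.
Qed.

Lemma recip32_gt0 k : 0 < recip32 k.
Proof. by rewrite /recip32 invr_gt0; have := ler0n R k; lra. Qed.

Lemma recip32_le1 k : recip32 k <= 1.
Proof. by rewrite /recip32 invf_le1; have := ler0n R k; lra. Qed.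

Lemma gapE n : gap R n = ((n%:R + 1) * (n%:R + 2))^-1.
Proof.
rewrite /gap -[in LHS]natr1 -[n.+2%:R]natr1 -natr1.
by field; rewrite !gt_eqF//; have := ler0n R n; lra.
Qed.

Lemma lnstep_ge0 n : 0 <= lnstep n.
Proof.
rewrite /lnstep; case: n => [|n]; first by rewrite ln1 ln0// subrr.
by rewrite subr_ge0 ler_ln ?posrE ?ltr0n// ler_nat.
Qed.

Lemma lnstep_le1 n : lnstep n <= 1.
Proof.
rewrite /lnstep; case: n => [|n]; first by rewrite ln1 ln0// subrr ler01.
have n0 : 0 < n.+1%:R :> R by rewrite ltr0n.
have /andP[_] := lnstep_bounds n0; rewrite natr1 => h; apply: le_trans h _.
by rewrite invf_le1// ler1n.
Qed.

(** For [n >= 1] the left side is at most [1 / n^2], and [1 / n^2 <= 6 gap n] is an equality at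
    [n = 1]. *)
Lemma lnstep_sqr n : lnstep n ^+ 2 <= 6 * gap R n.
Proof.
rewrite gapE /lnstep; case: n => [|n].
  by rewrite ln1 ln0// subrr expr0n/= mulr_ge0// invr_ge0 mulr_ge0//; lra.
have n0 : 1 <= n.+1%:R :> R by rewrite ler1n.
have := @lnstep_bounds n.+1%:R ltac:(lra).
have := lnstep_ge0 n.+1; rewrite /lnstep -[n.+2%:R]natr1.
move: (ln _ - ln _) => l; move: n.+1%:R n0 => x x1 l0 /andP[_ lx].
apply: le_trans (_ : x^-1 ^+ 2 <= _).
  by rewrite ler_pXn2r// nnegrE// invr_ge0; lra.
rewrite -subr_ge0.
have -> : 6 * ((x + 1) * (x + 2))^-1 - x^-1 ^+ 2 =
   (6 * x ^+ 2 - (x + 1) * (x + 2)) / (x ^+ 2 * (x + 1) * (x + 2)).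
  by field; rewrite !gt_eqF//; lra.
rewrite divr_ge0//; first by nra.
by rewrite !mulr_ge0 ?sqr_ge0//; lra.
Qed.

(** For [n >= 1] the difference lies between 0 and [1 / n - 1 / (n + 5/2)], which is of order 1 /
    n^2; for [n = 0] it is [- 2 / 5]. *)
Lemma delta_bound n : `|lnstep n - recip32 n.+1| <= 8 * gap R n.
Proof.
rewrite gapE /lnstep /recip32; case: n => [|n].
  rewrite ln1 ln0// subrr sub0r normrN gtr0_norm ?invr_gt0; last by lra.
  have -> : (3 / 2 + 1)^-1 = 2 / 5 :> R by field.
  have -> : ((0%:R + 1) * (0%:R + 2))^-1 = 2^-1 :> R by rewrite add0r add0r mul1r.
  by lra.
have n0 : 1 <= n.+1%:R :> R by rewrite ler1n.
have := @lnstep_bounds n.+1%:R ltac:(lra); rewrite -[n.+2%:R]natr1.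
move: (ln _ - ln _) => l; move: n.+1%:R n0 => x x1 /andP[xl lx].
rewrite ger0_norm; last first.
  rewrite subr_ge0; apply: le_trans xl; rewrite lef_pV2 ?posrE; lra.
apply: le_trans (lerD lx (lexx _)) _; rewrite -subr_ge0.
have -> : 8 * ((x + 1) * (x + 2))^-1 - (x^-1 - (3 / 2 + (x + 1))^-1) =
   (8 * x * (x + 5 / 2) - 5 / 2 * (x + 1) * (x + 2)) / (x * (x + 5 / 2) * (x + 1) * (x + 2)).
  by field; rewrite !gt_eqF//; lra.
rewrite divr_ge0//; first by nra.
by rewrite !mulr_ge0//; lra.
Qed.

Lemma cabs_inv1D w : cabs w <= 2^-1 -> 1 + w != 0 /\ cabs (1 + w)^-1 <= 2.
Proof.
move=> w2; have h1 : 1 <= cabs (1 + w) + cabs w.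
  by have := cabsB (1 + w) w; rewrite addrK cabs1.
have h2 : 2^-1 <= cabs (1 + w) by lra.
split; first by apply/eqP => w0; move: h2; rewrite w0 cabs0; lra.
by rewrite cabsV -(invrK 2) lef_pV2 ?posrE//; lra.
Qed.

Lemma cabs_mul_real_le w (x : R) : 0 <= x -> x <= 1 -> cabs (w * x%:C) <= cabs w.
Proof.
by move=> x0 x1; rewrite cabsM cabs_real ger0_norm// ler_piMr ?cabs_ge0.
Qed.

(** Over the denominator [1 + h a] the error is [(E - 1 - h L) - h^2 a (L - a)]. The constant is
    [256 = 2 (20 * 6 + 8)], from [cexp_taylor1] with [lnstep_sqr], from [delta_bound], and from the
    bound 2 on the inverse denominator. *)
Lemma ratio_step_expansion h n : cabs h <= 2^-1 ->
  cabs (ratio_step h n - 1 - h * (lnstep n - recip32 n.+1)%:C)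
    <= 256 * cabs h ^+ 2 * gap R n.
Proof.
move=> h2; rewrite /ratio_step.
have L0 := lnstep_ge0 n; have L1 := lnstep_le1 n; have LL := lnstep_sqr n.
have a0 := ltW (recip32_gt0 n.+1); have a1 := recip32_le1 n.+1.
have dl := delta_bound n; have hp := cabs_ge0 h.
move: (lnstep n) (recip32 n.+1) L0 L1 LL a0 a1 dl => L a L0 L1 LL a0 a1 dl.
have [na ia] := @cabs_inv1D (h * a%:C) (le_trans (cabs_mul_real_le h a0 a1) h2).
set E := cexp (h * L%:C).
have -> : E / (1 + h * a%:C) - 1 - h * (L - a)%:C =
  ((E - 1 - h * L%:C) - h * (h * a%:C) * (L - a)%:C) * (1 + h * a%:C)^-1.
  by rewrite rmorphB/=; field.
rewrite cabsM.
have bE : cabs (E - 1 - h * L%:C) <= 20 * (cabs h ^+ 2 * (6 * gap R n)).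
  apply: le_trans (cexp_taylor1 _) _.
    by apply: le_trans (cabs_mul_real_le h L0 L1) _; lra.
  rewrite cabsM cabs_real exprMn real_normK ?num_real//.
  by rewrite ler_wpM2l// ler_wpM2l ?sqr_ge0.
have bF : cabs (h * (h * a%:C) * (L - a)%:C) <= cabs h ^+ 2 * (8 * gap R n).
  rewrite cabsM cabs_real; apply: ler_pM => //; first exact: cabs_ge0.
  by rewrite cabsM expr2 ler_wpM2l// cabs_mul_real_le.
apply: le_trans (_ : (20 * (cabs h ^+ 2 * (6 * gap R n))
    + cabs h ^+ 2 * (8 * gap R n)) * 2 <= _).
  apply: ler_pM; rewrite ?cabs_ge0//.
  by apply: le_trans (cabsB _ _) _; exact: lerD.
lra.
Qed.

Lemma ratio_step_near1 h n : cabs h <= 2^-1 ->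
  cabs (ratio_step h n - 1) <= 256 * cabs h * gap R n.
Proof.
move=> h2; have := ratio_step_expansion n h2.
have dl := delta_bound n; have g0 := gap_ge0 R n.
set dd := (lnstep n - recip32 n.+1) in dl * => e.
have -> : ratio_step h n - 1 = (ratio_step h n - 1 - h * dd%:C) + h * dd%:C by ring.
apply: le_trans (cabsD _ _) _; rewrite cabsM cabs_real.
have h0 := cabs_ge0 h.
have e1 : cabs h * `|dd| <= cabs h * (8 * gap R n) by rewrite ler_wpM2l.
have e2 : cabs h ^+ 2 * gap R n <= 2^-1 * (cabs h * gap R n).
  by rewrite expr2 -!mulrA ler_wpM2r// mulr_ge0.
have e3 : 0 <= cabs h * gap R n by rewrite mulr_ge0.
by move: e; rewrite -!mulrA; lra.
Qed.

Lemma gamma_ratio0 h : gamma_ratio h 0 = (1 + h * (recip32 0)%:C)^-1.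
Proof.
rewrite /gamma_ratio big_ord_recl big_ord0 mulr1 ln0// mulr0.
by rewrite (cexp_real (0 : R)) expR0 mul1r.
Qed.

Lemma gamma_ratio0_near1 h : cabs h <= 2^-1 -> cabs (gamma_ratio h 0 - 1) <= 2 * cabs h.
Proof.
move=> h2; rewrite gamma_ratio0.
have a0 := ltW (recip32_gt0 0); have a1 := recip32_le1 0.
have hw := cabs_mul_real_le h a0 a1.
have [na ia] := @cabs_inv1D (h * (recip32 0)%:C) (le_trans hw h2).
move: (h * _) hw na ia => w hw na ia.
have -> : (1 + w)^-1 - 1 = - ((1 + w)^-1 * w) by field.
by rewrite cabsN cabsM; apply: ler_pM => //; rewrite cabs_ge0.
Qed.

Lemma gamma_ratio0_expansion h : cabs h <= 2^-1 ->
  cabs (gamma_ratio h 0 - 1 - h * (digamma_seq 0)%:C) <= 2 * cabs h ^+ 2.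
Proof.
move=> h2; rewrite gamma_ratio0 /digamma_seq big_ord_recl big_ord0 addr0 ln0// sub0r.
rewrite rmorphN/= mulrN opprK.
have a0 := ltW (recip32_gt0 0); have a1 := recip32_le1 0.
have hw := cabs_mul_real_le h a0 a1.
have [na ia] := @cabs_inv1D (h * (recip32 0)%:C) (le_trans hw h2).
move: (h * _) hw na ia => w hw na ia.
have -> : (1 + w)^-1 - 1 + w = (1 + w)^-1 * (w * w) by field.
by rewrite cabsM; apply: ler_pM; rewrite ?cabs_ge0// cabsM expr2 ler_pM ?cabs_ge0.
Qed.

End GammaRatio.

(** * Euler's constant and the value [2 - gamma - 2 ln 2] *)

Section EulerConstant.
Set Implicit Arguments.
Unset Strict Implicit.
Variable R : realType.

Definition harm n : R := \sum_(1 <= k < n.+1) k%:R^-1.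

Lemma harmS n : harm n.+1 = harm n + n.+1%:R^-1.
Proof. by rewrite /harm big_nat_recr. Qed.

(** [eulerGamma] is a [lim], so the existence of a limit has to be shown; the increments are at most
    [1 / n - 1 / (n + 1) <= 3 gap n] for [n >= 1]. *)
Lemma cvg_eulerGamma : harm n - ln n%:R @[n --> \oo] --> eulerGamma R.
Proof.
suff [l hl] : exists l : R, harm n - ln n%:R @[n --> \oo] --> l.
  by rewrite /eulerGamma (cvg_lim _ hl)//; exact: Rhausdorff.
apply: (@cvg_gap R _ 3) => // n.
have -> : harm n.+1 - ln n.+1%:R - (harm n - ln n%:R) = n.+1%:R^-1 - lnstep R n.
  by rewrite harmS /lnstep; ring.
rewrite gapE /lnstep; case: n => [|n].
  rewrite ln1 ln0// !subr0 invr1 normr1.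
  have -> : ((0%:R + 1) * (0%:R + 2))^-1 = 2^-1 :> R by rewrite add0r add0r mul1r.
  by lra.
have n0 : 1 <= n.+1%:R :> R by rewrite ler1n.
have := @lnstep_bounds R n.+1%:R ltac:(lra); rewrite -[n.+2%:R]natr1.
move: (ln _ - ln _) => l; move: n.+1%:R n0 => x x1 /andP[xl lx].
rewrite distrC ger0_norm ?subr_ge0//.
apply: le_trans (lerD lx (lexx _)) _; rewrite -subr_ge0.
have -> : 3 * ((x + 1) * (x + 2))^-1 - (x^-1 - (x + 1)^-1) =
   (3 * x - (x + 2)) / (x * (x + 1) * (x + 2)).
  by field; rewrite !gt_eqF//; lra.
by rewrite divr_ge0//; [lra | rewrite !mulr_ge0//; lra].
Qed.

(** The terms are [2 / (2 k + 3)]: twice the odd reciprocals from 3 to [2 n + 3], that is, all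
    reciprocals minus the even ones, minus 1. *)
Lemma sum_recip32 n :
  \sum_(k < n.+1) recip32 R k = 2 * harm (2 * n + 3) - harm n.+1 - 2.
Proof.
elim: n => [|n IH].
  rewrite big_ord_recl big_ord0 muln0 add0n !harmS /harm big_geq// /recip32 /= addr0.
  by field.
rewrite big_ord_recr/= IH.
have -> : (2 * n.+1 + 3 = (2 * n + 3).+2)%N by lia.
rewrite !harmS /recip32 -!natr1 natrD natrM.
have n0 := ler0n R n; field.
by rewrite !gt_eqF//; lra.
Qed.

Lemma cvg_digamma_seq :
  @digamma_seq R @ \oo --> 2 - eulerGamma R - 2 * ln 2.
Proof.
pose e n := harm n - ln n%:R : R.
have ee : e @ \oo --> eulerGamma R := cvg_eulerGamma.
have e1 : e n.+1 @[n --> \oo] --> eulerGamma R by rewrite cvg_shiftS.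
have e2 : e (2 * n + 3)%N @[n --> \oo] --> eulerGamma R.
  apply: (cvg_comp (fun n => 2 * n + 3)%N e _ ee) => A [N _ NA].
  by exists N => // n /= Nn; apply: NA => /=; lia.
(* The logarithms left over once each harmonic sum is paired with its own logarithm. *)
pose w n := ln n%:R + ln n.+1%:R - 2 * ln (2 * n + 3)%:R + 2 * ln 2 : R.
have w0 : w @ \oo --> 0.
  rewrite -cvg_shiftS.
  apply: (@squeeze_cvgr _ _ _ _ (fun n => -2 * harmonic n : R) (cst 0)); first last.
  - exact: cvg_cst.
  - by rewrite -(mulr0 (-2)); apply: cvgMl_tmp; exact: cvg_harmonic.
  apply: nearW => n; rewrite /harmonic/= /w.
  rewrite -[n.+2%:R]natr1 natrD natrM.
  have : 1 <= n.+1%:R :> R by rewrite ler1n.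
  move: n.+1%:R => x x1.
  have ix : 0 < x^-1 by rewrite invr_gt0; lra.
  have ix1 : 0 < (x + 1)^-1 by rewrite invr_gt0; lra.
  have ixx : (x + 1)^-1 <= x^-1 by rewrite lef_pV2 ?posrE; lra.
  (* Comparing [2 x + 3] once with [2 x] and once with [2 (x + 1)] writes the term of [w] as [- ln
     (1 + 3 / (2 x)) - ln (1 + 1 / (2 (x + 1)))], between [- 2 / x] and 0. *)
  have E1 : ln (2 * x + 3) = ln 2 + ln x + ln (1 + 3 / 2 * x^-1).
    rewrite -!lnM ?posrE//; try lra; congr ln; field; rewrite gt_eqF//; lra.
  have E2 : ln (2 * x + 3) = ln 2 + ln (x + 1) + ln (1 + 1 / 2 * (x + 1)^-1).
    rewrite -!lnM ?posrE//; try lra; congr ln; field; rewrite gt_eqF//; lra.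
  have h1 := @le_ln1Dx R (3 / 2 * x^-1) ltac:(lra).
  have h2 := @le_ln1Dx R (1 / 2 * (x + 1)^-1) ltac:(lra).
  have h3 := @ln_ge0 R (1 + 3 / 2 * x^-1) ltac:(lra).
  have h4 := @ln_ge0 R (1 + 1 / 2 * (x + 1)^-1) ltac:(lra).
  by apply/andP; split; lra.
have -> : @digamma_seq R = (fun n => e n.+1 - 2 * e (2 * n + 3)%N + (w n + (2 - 2 * ln 2))).
  by apply/funext => n; rewrite /digamma_seq sum_recip32 /e /w; ring.
have -> : 2 - eulerGamma R - 2 * ln 2 =
  eulerGamma R - 2 * eulerGamma R + (0 + (2 - 2 * ln 2)) by ring.
apply: cvgD; first by apply: cvgB => //; apply: cvgMl_tmp.
by apply: cvgD => //; exact: cvg_cst.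
Qed.

End EulerConstant.

(** * Gamma near 3/2, and the digamma function there *)

Section GammaThreeHalves.
Local Open Scope complex_scope.
Set Implicit Arguments.
Unset Strict Implicit.
Variable R : realType.
Implicit Types (z h : R[i]) (n : nat).

Definition gamma_seq z n : R[i] :=
  n`!%:R * cexp (z * (ln (n%:R : R))%:C) / \prod_(k < n.+1) (z + k%:R).

Definition gamma32_seq n : R :=
  n`!%:R * expR (3 / 2 * ln n%:R) / \prod_(k < n.+1) (3 / 2 + k%:R).

Lemma realc_natr n : (n%:R : R)%:C = n%:R.
Proof. by rewrite rmorph_nat. Qed.

Lemma gamma_seq_shift h n :
  gamma_seq (h + (3 / 2 : R)%:C) n = (gamma32_seq n)%:C * gamma_ratio h n.
Proof.
rewrite /gamma_seq /gamma32_seq /gamma_ratio.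
have -> : \prod_(k < n.+1) (h + (3 / 2 : R)%:C + k%:R) =
  (\prod_(k < n.+1) (3 / 2 + k%:R : R))%:C * \prod_(k < n.+1) (1 + h * (recip32 R k)%:C).
  rewrite rmorph_prod -big_split; apply: eq_bigr => k _ /=.
  rewrite mulrDr mulr1 mulrCA -rmorphM /recip32 mulfV ?mulr1; last first.
    by rewrite gt_eqF//; have := ler0n R k; lra.
  by rewrite rmorphD/= realc_natr; ring.
rewrite mulrDl cexpD -rmorphM/= cexp_real !rmorphM/= fmorphV/= realc_natr invfM.
by ring.
Qed.

Lemma gamma32_seq_gt0 n : 0 < gamma32_seq n.
Proof.
rewrite /gamma32_seq divr_gt0 ?mulr_gt0 ?expR_gt0 ?ltr0n ?fact_gt0//.
by apply: prodr_gt0 => k _; have := ler0n R k; lra.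
Qed.

(** Squaring removes the half-integer power, so that inequalities between approximants become
    polynomial. *)
Lemma expR_sqr_ln (x : R) : 0 < x -> expR (3 / 2 * ln x) ^+ 2 = x ^+ 3.
Proof.
move=> x0; have -> : x ^+ 3 = expR (3%:R * ln x) by rewrite expRM_natl lnK ?posrE.
by rewrite expr2 -expRD; congr expR; field.
Qed.

(* (3/2 + k)^2 >= (1 + k) (2 + k) bounds the square by the product of the
   approximants at 1 and 2. *)
Lemma gamma32_seq_le1 n : gamma32_seq n.+1 <= 1.
Proof.
rewrite -(@ler_pXn2r _ 2)// ?nnegrE ?ler01 ?(ltW (gamma32_seq_gt0 _))// expr1n.
rewrite /gamma32_seq expr_div_n exprMn expR_sqr_ln ?ltr0n//.
have p0 : 0 < \prod_(k < n.+2) (3 / 2 + k%:R : R).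
  by apply: prodr_gt0 => k _; have := ler0n R k; lra.
rewrite ler_pdivrMr ?exprn_gt0// mul1r.
have key m : (m.+1)`!%:R * (m.+2)`!%:R <= (\prod_(k < m.+1) (3 / 2 + k%:R : R)) ^+ 2.
  elim: m => [|m IH].
    rewrite big_ord_recl big_ord0 mulr1 addr0 !factS fact0 !muln1 mul1r; lra.
  rewrite big_ord_recr/= exprMn.
  have -> : (m.+2)`!%:R * (m.+3)`!%:R =
    (m.+1)`!%:R * (m.+2)`!%:R * (m.+2%:R * m.+3%:R) :> R.
    by rewrite [(m.+3)`!]factS [(m.+2)`!]factS !natrM; ring.
  apply: ler_pM; rewrite ?mulr_ge0//.
  rewrite -[m.+3%:R]natr1 -[m.+2%:R]natr1; have := ler0n R m.+1; nra.
apply: le_trans (key n.+1).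
have f0 : 0 <= n.+1`!%:R ^+ 2 :> R by rewrite sqr_ge0.
have -> : (n.+2)`!%:R * (n.+3)`!%:R =
  (n.+1)`!%:R ^+ 2 * (n.+2%:R * n.+3%:R * n.+2%:R) :> R.
  by rewrite [(n.+3)`!]factS [(n.+2)`!]factS !natrM; ring.
apply: ler_wpM2l => //; rewrite -[n.+3%:R]natr1 -[n.+2%:R]natr1.
have := ler0n R n.+1; nra.
Qed.

(** After squaring this is [x^3 (x + 5/2)^2 <= (x + 1)^5] with [x = n + 1]. The index starts at 1:
    because [ln 0 = 0], the terms at 0 and 1 are 2/3 and 4/15. *)
Lemma gamma32_seq_nondecreasing n : gamma32_seq n.+1 <= gamma32_seq n.+2.
Proof.
rewrite -(@ler_pXn2r _ 2)// ?nnegrE ?(ltW (gamma32_seq_gt0 _))//.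
rewrite /gamma32_seq [in leRHS]big_ord_recr/= [(n.+2)`!]factS natrM.
have p0 : 0 < \prod_(k < n.+2) (3 / 2 + k%:R : R).
  by apply: prodr_gt0 => k _; have := ler0n R k; lra.
move: (\prod_(k < n.+2) _) p0 => P p0.
have f0 : 0 < (n.+1)`!%:R :> R by rewrite ltr0n fact_gt0.
move: (_`!%:R) f0 => F f0.
rewrite !expr_div_n !exprMn !expR_sqr_ln ?ltr0n//.
have := ltr0Sn R n; rewrite -[n.+2%:R]natr1; move: n.+1%:R => x x0.
rewrite -subr_ge0.
have -> : (x + 1) ^+ 2 * F ^+ 2 * (x + 1) ^+ 3 / (P ^+ 2 * (3 / 2 + (x + 1)) ^+ 2) -
    F ^+ 2 * x ^+ 3 / P ^+ 2 =
  F ^+ 2 * ((x + 1) ^+ 5 - x ^+ 3 * (x + 5 / 2) ^+ 2) / (P ^+ 2 * (x + 5 / 2) ^+ 2).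
  by field; rewrite !gt_eqF//; lra.
have -> : (x + 1) ^+ 5 - x ^+ 3 * (x + 5 / 2) ^+ 2 =
  15 / 4 * x ^+ 3 + 10 * x ^+ 2 + 5 * x + 1 by field.
apply: divr_ge0; apply: mulr_ge0; rewrite ?sqr_ge0//.
have := exprn_gt0 3 x0; have := exprn_gt0 2 x0; lra.
Qed.

(** By monotonicity the limit is at least the term at 1; its positivity permits the division in
    [digamma]. *)
Lemma cvg_gamma32_seq : exists2 g : R, 0 < g & gamma32_seq @ \oo --> g.
Proof.
have nd : nondecreasing_seq (fun n => gamma32_seq n.+1).
  by apply/nondecreasing_seqP => n; exact: gamma32_seq_nondecreasing.
have /cvg_ex[g hg] : cvgn (fun n => gamma32_seq n.+1).
  by apply: nondecreasing_is_cvgn => //; exists 1 => _ [n _ <-]; exact: gamma32_seq_le1.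
exists g; last by rewrite -cvg_shiftS.
apply: lt_le_trans (gamma32_seq_gt0 1) _.
by apply: (cvgr_to_ge hg); apply: nearW => n; exact: (nd 0%N n).
Qed.

Lemma gamma_ratio_limit (Dl : R) : @digamma_seq R @ \oo --> Dl ->
  exists K d : R, [/\ 0 <= K, 0 < d &
  forall h, cabs h <= d -> exists q : R[i],
    [/\ forall n, cabs (gamma_ratio h n) <= 2,
        cabs (gamma_ratio h n - q) @[n --> \oo] --> (0 : R) &
        cabs (q - 1 - h * Dl%:C) <= K * cabs h ^+ 2]].
Proof.
move=> hDl; have [C [C2 r1 r2]] : exists C : R, [/\ 2 <= C,
    forall h n, cabs h <= 2^-1 -> cabs (ratio_step h n - 1) <= C * cabs h * gap R n &
    forall h n, cabs h <= 2^-1 ->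
      cabs (ratio_step h n - 1 - h * (lnstep R n - recip32 R n.+1)%:C)
        <= C * cabs h ^+ 2 * gap R n].
  exists 256; split; [lra | exact: ratio_step_near1 | exact: ratio_step_expansion].
have C0 : 0 <= C by lra.
(* This radius is what [3 C |h| <= 1] requires; as [C >= 2], it also gives [|h| <= 1/2]. *)
exists (2 * C + 3 * C ^+ 2), (3 * C)^-1.
have i0 : 0 < (3 * C)^-1 by rewrite invr_gt0; lra.
split => // [|h hd]; first by rewrite addr_ge0 ?mulr_ge0 ?sqr_ge0.
have h0 := cabs_ge0 h.
have hC : 3 * C * cabs h <= 1.
  have C3 : 0 < 3 * C by lra.
  by rewrite mulrC -ler_pdivlMr// mul1r.
have h2 : cabs h <= 2^-1 by apply: le_trans hd _; rewrite lef_pV2 ?posrE; lra.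
have Q0 : cabs (gamma_ratio h 0 - 1) <= C * cabs h.
  by apply: le_trans (gamma_ratio0_near1 h2) _; rewrite ler_wpM2r.
have Q0' : cabs (gamma_ratio h 0 - 1 - h * (digamma_seq R 0)%:C) <= C * cabs h ^+ 2.
  by apply: le_trans (gamma_ratio0_expansion h2) _; rewrite ler_wpM2r ?sqr_ge0.
have QS := gamma_ratioS h; have DS := @digamma_seqS R.
have r1' n := r1 h n h2; have r2' n := r2 h n h2.
have B0 : 0 <= 2 * (C * cabs h) by rewrite !mulr_ge0.
have [q hq] := ccvg_gap B0 (prod_step C0 hC Q0 QS r1').
exists q; split => //; first exact: (prod_bounded C0 hC Q0 QS r1').
(* Triangle inequality through the [n]-th ratio; the first and last terms vanish in the limit, and
   the middle one does not depend on [n]. *)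
have bnd n : cabs (q - 1 - h * Dl%:C) <=
    cabs (gamma_ratio h n - q) + (2 * C + 3 * C ^+ 2) * cabs h ^+ 2
    + cabs h * `|digamma_seq R n - Dl|.
  have -> : q - 1 - h * Dl%:C = - (gamma_ratio h n - q)
    + (gamma_ratio h n - 1 - h * (digamma_seq R n)%:C) + h * (digamma_seq R n - Dl)%:C.
    by move: (digamma_seq R n) => x; rewrite rmorphB/=; ring.
  apply: le_trans (cabsD _ _) _; rewrite cabsM cabs_real lerD2r.
  apply: le_trans (cabsD _ _) _; rewrite cabsN lerD2l.
  exact: (prod_expansion C0 hC Q0 Q0' QS DS r1' r2').
have cv : cabs (gamma_ratio h n - q) + (2 * C + 3 * C ^+ 2) * cabs h ^+ 2
    + cabs h * `|digamma_seq R n - Dl| @[n --> \oo] -->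
    0 + (2 * C + 3 * C ^+ 2) * cabs h ^+ 2 + cabs h * 0.
  apply: cvgD; first by apply: cvgD => //; exact: cvg_cst.
  apply: cvgMl_tmp; rewrite -(@normr0 _ R); apply: cvg_norm; exact/subr_cvg0.
rewrite add0r mulr0 addr0 in cv.
by apply: (cvgr_to_ge cv); apply: nearW => n; exact: bnd.
Qed.

Lemma cGamma_expansion (Dl : R) : @digamma_seq R @ \oo --> Dl ->
  exists g K d : R, [/\ 0 < g, 0 <= K, 0 < d &
  forall h, cabs h <= d -> cabs (cGamma (h + (3 / 2 : R)%:C) - g%:C
     - h * (g * Dl)%:C) <= K * cabs h ^+ 2].
Proof.
move=> hDl; have [g g0 hg] := cvg_gamma32_seq.
have [K [d [K0 d0 H]]] := gamma_ratio_limit hDl.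
exists g, (g * K), d; split => //; first by rewrite mulr_ge0// ltW.
move=> h /H[q [q2 hq qE]].
have -> : cGamma (h + (3 / 2 : R)%:C) = g%:C * q.
  apply: lim_cabs.
  have h0 : `|gamma32_seq n - g| * 2 + g * cabs (gamma_ratio h n - q) @[n --> \oo]
    --> 0 * 2 + g * 0.
    apply: cvgD; last exact: cvgMl_tmp.
    by apply: cvgMr_tmp; rewrite -(@normr0 _ R); apply: cvg_norm; apply/subr_cvg0.
  rewrite mul0r mulr0 addr0 in h0.
  apply: squeeze_cvgr (cvg_cst 0) h0; apply: nearW => n; rewrite cabs_ge0/=.
  rewrite -[X in cabs (X - _)]/(gamma_seq _ n) gamma_seq_shift.
  have -> : (gamma32_seq n)%:C * gamma_ratio h n - g%:C * q =
    (gamma32_seq n - g)%:C * gamma_ratio h n + g%:C * (gamma_ratio h n - q).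
    by rewrite rmorphB/=; ring.
  apply: le_trans (cabsD _ _) _.
  rewrite (cabsM _ (gamma_ratio h n)) (cabsM _ (_ - q)) !cabs_real (gtr0_norm g0).
  by rewrite lerD2r ler_wpM2l ?q2.
rewrite rmorphM/=.
have -> : g%:C * q - g%:C - h * (g%:C * Dl%:C) =
  g%:C * (q - 1 - h * Dl%:C) by ring.
by rewrite cabsM cabs_real gtr0_norm// -mulrA ler_wpM2l// ltW.
Qed.

Lemma rdigamma32_lim (Dl : R) : @digamma_seq R @ \oo --> Dl ->
  rdigamma (3 / 2 : R) = Dl.
Proof.
move=> /cGamma_expansion[g [K [d [g0 K0 d0 H]]]].
have g32 : cGamma (3 / 2 : R)%:C = g%:C.
  apply/eqP; rewrite -subr_eq0; apply/eqP/cabs_eq0/eqP.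
  have := H 0; rewrite cabs0 expr0n mulr0 mul0r subr0 add0r => /(_ (ltW d0)) h.
  by rewrite eq_le h cabs_ge0.
rewrite /rdigamma /digamma g32.
suff -> : derive1 (@cGamma R) (3 / 2 : R)%:C = (g * Dl)%:C.
  by rewrite -fmorphV -rmorphM/= mulrAC mulfV ?mul1r// gt_eqF.
rewrite /derive1; apply: lim_cabs; rewrite g32.
apply/cvgr0Pnorm_lt => e e0.
(* The difference quotient is within [K |h|] of [g Dl]; [K + 1] replaces [K], which may be 0. *)
pose m := Num.min d (e / (K + 1)).
have K1 : 0 < K + 1 by rewrite ltr_wpDl.
have m0 : 0 < m by rewrite lt_min d0 divr_gt0.
have := near0_cabs m0; apply: filterS => h [h0].
rewrite lt_min => /andP[hd he].
rewrite ger0_norm ?cabs_ge0//.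
have -> : h^-1 *: (cGamma (h + (3 / 2 : R)%:C) - g%:C : R[i]^o) - (g * Dl)%:C =
  h^-1 * (cGamma (h + (3 / 2 : R)%:C) - g%:C - h * (g * Dl)%:C).
  by rewrite /GRing.scale/= [in RHS]mulrBr mulKf.
rewrite cabsM cabsV; apply: le_lt_trans (_ : K * cabs h < _).
  rewrite ler_pdivrMl ?cabs_gt0// mulrCA -expr2; exact/H/ltW.
move: he; rewrite ltr_pdivlMr// => he.
by apply: le_lt_trans he; rewrite mulrC ler_wpM2l ?cabs_ge0// lerDl.
Qed.

Lemma rdigamma32 : rdigamma (3 / 2 : R) = 2 - eulerGamma R - 2 * ln 2.
Proof. exact: rdigamma32_lim (@cvg_digamma_seq R). Qed.

End GammaThreeHalves.

(** * The minimum point and the threshold *)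

Section Threshold.
Set Implicit Arguments.
Unset Strict Implicit.
Variable R : realType.
Implicit Types (x alpha : R).

Lemma xmin_gt0 : 0 < xmin R.
Proof. by rewrite /xmin; have := sqrtr_ge0 (30 : R); lra. Qed.

(** [xmin] is the positive root of [24 x^2 - x - 17 / 1440]. *)
Lemma xmin_root : 24 * xmin R - 17 / 1440 / xmin R = 1.
Proof.
have x0 := xmin_gt0.
have h : 24 * xmin R ^+ 2 - 17 / 1440 = xmin R.
  rewrite /xmin; have := @sqr_sqrtr R 30 ltac:(lra).
  set t := Num.sqrt 30 => ht.
  have -> : 24 * ((15 + 4 * t) / 720) ^+ 2 - 17 / 1440 =
    (225 + 120 * t + 16 * t ^+ 2) / 21600 - 17 / 1440 by field.
  by rewrite ht; field.
have x1 : xmin R != 0 by rewrite gt_eqF.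
by apply: (mulfI x1); rewrite mulr1 -[RHS]h; field; exact: x1.
Qed.

(** By [xmin_root] the rational part is [48 xmin - 1], which is [4 sqrt 30 / 15]. *)
Lemma fbase_xmin : fbase (17 / 1440) (xmin R) =
  4 * Num.sqrt (2 / 15) + 4 * ln 2 + ln (68^-1 * (4 * Num.sqrt 30 - 15)).
Proof.
have x0 := xmin_gt0; have rt := xmin_root; rewrite /fbase.
have -> : 17 / 1440 / xmin R = 24 * xmin R - 1 by lra.
have h30 := @sqr_sqrtr R 30 ltac:(lra).
have -> : Num.sqrt (2 / 15) = Num.sqrt 30 / 15 :> R.
  rewrite (_ : 2 / 15 = 30 / 15 ^+ 2); last by field.
  rewrite sqrtrM; last by lra.
  by rewrite sqrtrV ?sqr_ge0// sqrtr_sqr ger0_norm; last by lra.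
have s0 := sqrtr_ge0 (30 : R).
have s4 : 4 < Num.sqrt (30 : R).
  by rewrite -(@ltr_pXn2r _ 2)// ?nnegrE// h30; lra.
(* The arguments of the three logarithms multiply to 1, since [(4 t - 15) (4 t + 15) = 255] for
   [t = sqrt 30]. *)
have E : 4 * ln 2 + ln (68^-1 * (4 * Num.sqrt 30 - 15)) = - ln (12 * xmin R) :> R.
  rewrite mulr_natl -lnXn; last by lra.
  set t := Num.sqrt 30 in h30 s0 s4 *.
  have t0 : 0 < 68^-1 * (4 * t - 15) by lra.
  have u0 : 0 < 12 * ((15 + 4 * t) / 720) by lra.
  rewrite -lnM ?posrE ?exprn_gt0// /xmin -/t -lnV ?posrE//; congr ln.
  apply: (mulIf (lt0r_neq0 u0)); rewrite mulVf ?lt0r_neq0//.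
  have -> : 2 ^+ 4 * (68^-1 * (4 * t - 15)) * (12 * ((15 + 4 * t) / 720)) =
    (16 * t ^+ 2 - 225) / 255 by field.
  by rewrite h30; field.
by rewrite -[RHS]addrA E; move: (ln _) => l; rewrite /xmin; lra.
Qed.

Definition level alpha : R := 12 * alpha + 8 / 3 - 2 * rdigamma (3 / 2).

Lemma fsolE alpha x : 0 < x -> fsol alpha x = fbase (17 / 1440) x - level alpha.
Proof.
move=> x0; rewrite /fsol /fbase /level.
have -> : 17 / (1440 * x) = 17 / 1440 / x by field; rewrite gt_eqF.
by lra.
Qed.

(** In [2 psi(3/2) = 4 - 2 gamma - 4 ln 2] the last term cancels the [4 ln 2] of [fbase_xmin], and
    [4 - 8/3 = 4/3]. *)
Lemma fbase_xmin_level alpha :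
  fbase (17 / 1440) (xmin R) - level alpha = Cthr R - 12 * alpha.
Proof. rewrite fbase_xmin /level /Cthr rdigamma32; lra. Qed.

End Threshold.

(** * From the semi-classical Einstein equation to a scalar equation *)

Section Physics.
Set Implicit Arguments.
Unset Strict Implicit.
Variable R : realType.
Implicit Types (Lambda alpha msq : R) (p : 'rV[R]_4).

Lemma psiSum_nu0 Lambda msq : 0 < Lambda ->
  psiSum (4 * Lambda) msq (3 / 16 - msq / (4 * Lambda)) = 2 * rdigamma (3 / 2).
Proof.
move=> L0; rewrite /psiSum /nu.
have -> : 9 / 4 - 12 * (msq / (4 * Lambda) + (3 / 16 - msq / (4 * Lambda))) = 0 :> R by lra.
by rewrite rmorph0 sqrtC0 addr0 subr0 raddfD [RHS]mulr_natl [RHS]mulr2n.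
Qed.

(** For this coupling [m^2 + (xi - 1/6) R = Lambda / 12], so [Lambda m^2 / 12] factors out; the
    terms free of [m^2] become [17 / (1440 x)]. *)
Lemma stressEnergy_nu0 Lambda alpha msq (a b : 'I_4) p :
  0 < Lambda -> 0 < msq -> p 0 0 != 0 ->
  stressEnergy Lambda alpha msq (3 / 16 - msq / (4 * Lambda)) a b p =
  deSitter Lambda p a b / (8 * pi) ^+ 2 *
    (Lambda * msq / 12 * fsol alpha (msq / (4 * Lambda))).
Proof.
move=> L0 m0 p0; rewrite /stressEnergy scalarCurvature_deSitter// psiSum_nu0// /fsol.
have -> : 12 * msq / (4 * Lambda) = 12 * (msq / (4 * Lambda)) by rewrite mulrA.
move: (@pi R) (@pi_gt0 R) => w w0.
move: (ln _) (rdigamma _) (deSitter _ _ _ _) => l d g.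
by field; rewrite !gt_eqF.
Qed.

Lemma deSitter00_neq0 Lambda p : 0 < Lambda -> p 0 0 != 0 -> deSitter Lambda p 0 0 != 0.
Proof.
move=> L0 p0; rewrite deSitterE !mxE /minkowski /= mulrN1 oppr_eq0.
by rewrite !mulf_neq0 ?invr_eq0 ?expf_neq0// gt_eqF.
Qed.

Lemma halfLine_neq0 s p : halfLine s p -> p 0 0 != 0.
Proof. by move=> h; apply/eqP => p0; move: h; rewrite /halfLine/= p0 mulr0 ltxx. Qed.

Lemma halfLine_nonempty s : exists p : 'rV[R]_4, halfLine s p.
Proof.
exists (const_mx ((-1) ^+ s)); rewrite /halfLine/= mxE.
by case: s; rewrite /= ?expr0 ?expr1 ?mulrNN mulr1.
Qed.

(** One nonzero component at one point, here the time-time one, already forces the scalar factor to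
    vanish; conversely that factor is common to all components and points. *)
Lemma solutionP s Lambda GN alpha msq : 0 < Lambda -> 0 < GN ->
  solution s Lambda GN alpha msq <-> 0 < msq /\ fsol alpha (msq / (4 * Lambda)) = 0.
Proof.
move=> L0 G0; split=> -[m0 H]; split=> //.
  have [p hp] := halfLine_nonempty s.
  have p0 := halfLine_neq0 hp.
  have := H p hp 0 0; rewrite einstein_deSitter// stressEnergy_nu0//.
  move/esym/eqP; rewrite !mulf_eq0 !invr_eq0 expf_eq0 /= !mulf_eq0.
  rewrite (negPf (deSitter00_neq0 L0 p0)) !(gt_eqF L0) !(gt_eqF m0) !(gt_eqF G0).
  rewrite !(gt_eqF (pi_gt0 R)) !pnatr_eq0 /=.
  by move/eqP.
move=> p hp a b; have p0 := halfLine_neq0 hp.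
by rewrite einstein_deSitter// stressEnergy_nu0// H !mulr0.
Qed.
End Physics.

(** * Counting solutions in the variable [x = m^2 / (4 Lambda)] *)

Section SolutionSet.
Set Implicit Arguments.
Unset Strict Implicit.
Variable R : realType.
Implicit Types (Lambda alpha msq : R).

(* The coefficient 17 / 1440 is hidden behind [c] because unification would
   unfold its unary numerals. *)
Lemma solution_fbaseP : exists c : R, [/\ 0 < c, 24 * xmin R - c / xmin R = 1,
  forall alpha, fbase c (xmin R) - level alpha = Cthr R - 12 * alpha &
  forall s Lambda GN alpha x, 0 < Lambda -> 0 < GN ->
    solution s Lambda GN alpha (4 * x * Lambda) <->
    0 < x /\ fbase c x = level alpha].
Proof.
exists (17 / 1440); split; [lra | exact: xmin_root | exact: fbase_xmin_level |].
move=> s Lambda GN alpha x L0 G0.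
have -> : (0 < x) = (0 < 4 * x * Lambda) by rewrite pmulr_lgt0// pmulr_rgt0.
have e : 4 * x * Lambda / (4 * Lambda) = x by field; rewrite gt_eqF.
apply: (iff_trans (solutionP _ _ _ L0 G0)); rewrite e.
split=> -[m0]; have x0 : 0 < x by move: m0; rewrite pmulr_lgt0// pmulr_rgt0.
  by rewrite fsolE// => /subr0_eq.
by move=> h; rewrite fsolE// h subrr.
Qed.

End SolutionSet.

Theorem mainTheorem2 (R : realType) (s : bool) (Lambda GN alpha : R)
    (hLambda : 0 < Lambda) (hGN : 0 < GN) :
  (forall msq : R, 0 < msq ->
     (solution s Lambda GN alpha msq <->
      fsol alpha (msq / (4 * Lambda)) = 0)) /\
  (Cthr R <= 12 * alpha ->
     exists msq : R, solution s Lambda GN alpha msq) /\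
  (12 * alpha = Cthr R ->
     forall msq : R, solution s Lambda GN alpha msq <->
                    msq = 4 * xmin R * Lambda) /\
  (Cthr R < 12 * alpha ->
     exists msqa msqb : R,
       [/\ msqa < 4 * xmin R * Lambda,
           4 * xmin R * Lambda < msqb &
           forall msq : R, solution s Lambda GN alpha msq <->
                          msq = msqa \/ msq = msqb]).
Proof.
split; first by move=> msq m0; rewrite solutionP//; split=> [[]|].
have [c [c0 root lev sol]] := solution_fbaseP R.
have {}sol x := sol s Lambda GN alpha x hLambda hGN.
have {}lev := lev alpha.
have m0 := @xmin_gt0 R.
have L4 : 0 < 4 * Lambda by rewrite mulr_gt0.
have scaleE x : 4 * x * Lambda = 4 * Lambda * x by rewrite mulrAC.
have scale msq : exists x, msq = 4 * x * Lambda.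
  by exists (msq / (4 * Lambda)); rewrite scaleE mulrC divfK ?gt_eqF.
have scale_inj x y : 4 * x * Lambda = 4 * y * Lambda -> x = y.
  by rewrite !scaleE; apply: mulfI; rewrite gt_eqF.
have scale_lt x y : (4 * x * Lambda < 4 * y * Lambda) = (x < y).
  by rewrite !scaleE (ltr_pM2l L4).
have eqcase : 12 * alpha = Cthr R -> forall msq,
    solution s Lambda GN alpha msq <-> msq = 4 * xmin R * Lambda.
  move=> ae msq; have fm : fbase c (xmin R) = level alpha.
    by apply/subr0_eq; rewrite lev ae subrr.
  have [x ->] := scale msq; rewrite sol; split=> [[x0 fx]|/scale_inj ->//].
  congr (4 * _ * _); apply/eqP; apply: contraT => xm.
  by have := fbase_gt_min c0 m0 root x0 xm; rewrite fx fm ltxx.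
have gtcase : Cthr R < 12 * alpha -> exists msqa msqb : R,
    [/\ msqa < 4 * xmin R * Lambda, 4 * xmin R * Lambda < msqb &
      forall msq : R, solution s Lambda GN alpha msq <-> msq = msqa \/ msq = msqb].
  move=> ac; have fm : fbase c (xmin R) < level alpha.
    by rewrite -subr_lt0 lev subr_lt0.
  have [a /andP[a0 am] fa] := fbase_root_left c0 m0 fm.
  have [b mb fb] := fbase_root_right c0 m0 fm.
  exists (4 * a * Lambda), (4 * b * Lambda); rewrite !scale_lt; split=> // msq.
  (* On each side of [xmin] the function is injective, so a solution is the root already found on
     its side. *)
  have [x ->] := scale msq; rewrite sol; split=> [[x0 fx]|[/scale_inj->|/scale_inj->]]//.
    have [xm|mx] := leP x (xmin R); [left|right]; congr (4 * _ * _).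
      by apply: (fbase_inj_left c0 m0 root) => //; rewrite ?(ltW am)// fx.
    by apply: (fbase_inj_right c0 m0 root); rewrite ?(ltW mb) ?(ltW mx)// fx.
  by split=> //; exact: lt_trans mb.
split; last by split.
rewrite le_eqVlt => /orP[/eqP ac|ac].
  by exists (4 * xmin R * Lambda); apply/(eqcase (esym ac)).
by have [ma [mb [_ _ H]]] := gtcase ac; exists ma; apply/H; left.
Qed.
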